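(* Let $\varepsilon\in(0,1/2)$, let $(\mathcal{N},\mathcal{I})$ be a $k$-extendible system on a ground set of size $n$, let $f:2^{\mathcal{N}}\to\mathbb{R}_{\ge0}$ be non-negative submodular, and run FastSGS with $\ell=k+1$ solutions and parameter $\varepsilon$. Then FastSGS makes $\tilde O(k^2n/\varepsilon)$ oracle calls and produces an independent set whose approximation ratio is at most $(1-2\varepsilon)^{-2}\cdot(k+1)^2/k$. Moreover, when $f$ is non-negative monotone submodular and the number of solutions satisfies $\ell\le k+1$, the approximation ratio improves to $(1-\varepsilon)^{-2}(k+1)$.
   Context: $\mathcal{N}$ finite ground set, $|\mathcal{N}|=n$. $f$ submodular: $f(X\cup Y)+f(X\cap Y)\le f(X)+f(Y)$; monotone: $f(A)\le f(B)$ for $A\subseteq B$; $f(u\mid S)=f(S\cup\{u\})-f(S)$; $S+u=S\cup\{u\}$. An independence system is a non-empty down-closed $\mathcal{I}\subseteq2^{\mathcal{N}}$; it is $k$-extendible if for all $A\subseteq B\in\mathcal{I}$ and $u\notin B$ with $A+u\in\mathcal{I}$ there is $Y\subseteq B\setminus A$, $|Y|\le k$, with $(B\setminus Y)\cup\{u\}\in\mathcal{I}$. Assume $\{u\}\in\mathcal{I}$ for all $u$. $OPT$ maximizes $f$ over $\mathcal{I}$; approximation ratio at most $\alpha$ means $f(S)\ge f(OPT)/\alpha$. Oracle calls are calls to the value oracle for $f$ and the independence oracle for $\mathcal{I}$; $\tilde O$ hides polylogarithmic factors. FastSGS$(\mathcal{N},f,\mathcal{I},\ell,\varepsilon)$: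 initialize $\ell$ solutions $S^{(1)},\dots,S^{(\ell)}$ to $\varnothing$ and an available set $A=\mathcal{N}$. Let $\Delta_f=\max_{u\in\mathcal{N}}f(\{u\})$ and $\tau=\Delta_f$. While $\tau>(\varepsilon/n)\Delta_f$: for every element-solution pair $(u,j)$ with $u$ in the current available set and $1\le j\le\ell$, if $S^{(j)}+u\in\mathcal{I}$ and $f(u\mid S^{(j)})\ge\tau$, add $u$ to $S^{(j)}$ and remove $u$ from the available set; after the pass set $\tau\leftarrow(1-\varepsilon)\tau$. Output the set maximizing $f$ among $S^{(1)},\dots,S^{(\ell)}$. *)

(* Defs.v *)
From mathcomp Require Import all_boot all_order all_algebra.
From mathcomp Require Import reals exp.

Set Implicit Arguments.
Unset Strict Implicit.
Unset Printing Implicit Defensive.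

Import Order.TTheory GRing.Theory Num.Theory.
Local Open Scope ring_scope.

Section SetFunctions.
Variables (R : realType) (N : finType).
Implicit Types (f : {set N} -> R) (I : {set {set N}}) (A B X Y S O : {set N}).

Definition nonnegative f := forall S, 0 <= f S.

Definition submodular f :=
  forall X Y, f (X :|: Y) + f (X :&: Y) <= f X + f Y.

Definition monotone f := forall A B, A \subset B -> f A <= f B.

Definition independence_system I :=
  I != set0 /\ (forall A B, A \subset B -> B \in I -> A \in I).

Definition extendible (k : nat) I :=
  independence_system I /\
  forall A B (u : N), A \subset B -> B \in I -> u \notin B -> u |: A \in I ->
    exists Y, [/\ Y \subset B :\: A, (#|Y| <= k)%N & u |: (B :\: Y) \in I].

Definition optimal f I O := O \in I /\ (forall S, S \in I -> f S <= f O).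

Definition approx_ratio_le (alpha : R) f I S :=
  forall OPT, optimal f I OPT -> f OPT / alpha <= f S.

End SetFunctions.

(* An algorithm sees the set function and the independence system only through
   queries, so it is a tree branching on the answers; [exec f I p] is the result
   of [p] together with the number of queries made to either oracle. *)
Section OraclePrograms.
Variables (R : realType) (N : finType).

Inductive prog (T : Type) : Type :=
  | Ret of T
  | AskValue of {set N} & (R -> prog T)
  | AskIndep of {set N} & (bool -> prog T).

Fixpoint bind (T U : Type) (p : prog T) (c : T -> prog U) : prog U :=
  match p with
  | Ret x => c x
  | AskValue X q => AskValue X (fun v => bind (q v) c)
  | AskIndep X q => AskIndep X (fun b => bind (q b) c)
  end.

Fixpoint exec (T : Type) (f : {set N} -> R) (I : {set {set N}}) (p : prog T) :
    T * nat :=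
  match p with
  | Ret x => (x, 0%N)
  | AskValue X q => let: (x, m) := exec f I (q (f X)) in (x, m.+1)
  | AskIndep X q => let: (x, m) := exec f I (q (X \in I)) in (x, m.+1)
  end.

End OraclePrograms.

Arguments Ret {R N T} _.
Arguments AskValue {R N T} _ _.
Arguments AskIndep {R N T} _ _.

Section FastSGS.
Variables (R : realType) (N : finType) (l : nat) (eps : R).

(* [ord i] is the order in which pass number [i] goes through the pairs. *)
Variable ord : nat -> seq (N * 'I_l).

Record state :=
  State { available : {set N}; solution : {ffun 'I_l -> {set N}} }.

Definition init_state := State setT [ffun=> set0].

Definition add_to (st : state) (u : N) (j : 'I_l) : state :=
  State (available st :\ u)
        [ffun i => if i == j then u |: solution st i else solution st i].

Definition try_pair (tau : R) (st : state) (p : N * 'I_l) : prog R N state :=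
  let: (u, j) := p in
  let S := solution st j in
  if u \in available st then
    AskIndep (u |: S) (fun indep =>
      if indep then
        AskValue (u |: S) (fun fSu => AskValue S (fun fS =>
          Ret (if tau <= fSu - fS then add_to st u j else st)))
      else Ret st)
  else Ret st.

Fixpoint pass (tau : R) (s : seq (N * 'I_l)) (st : state) : prog R N state :=
  if s is p :: s' then bind (try_pair tau st p) (pass tau s') else Ret st.

(* [None] when the loop condition still holds after [fuel] passes. *)
Fixpoint while_loop (Delta : R) (fuel i : nat) (tau : R) (st : state) :
    prog R N (option state) :=
  if eps / #|N|%:R * Delta < tau then
    if fuel is fuel'.+1 then
      bind (pass tau (ord i) st)
           (while_loop Delta fuel' i.+1 ((1 - eps) * tau))
    else Ret None
  else Ret (Some st).

Fixpoint max_singleton (acc : R) (us : seq N) : prog R N R :=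
  if us is u :: us' then
    AskValue [set u] (fun v => max_singleton (Num.max acc v) us')
  else Ret acc.

Fixpoint best_set (best : option ({set N} * R)) (s : seq {set N}) :
    prog R N (option {set N}) :=
  if s is X :: s' then
    AskValue X (fun v =>
      best_set (if best is Some (Y, w)
                then if w < v then Some (X, v) else Some (Y, w)
                else Some (X, v)) s')
  else Ret (omap fst best).

(* Starting the maximum at 0 is harmless: the set function is non-negative. *)
Definition fastSGS (fuel : nat) : prog R N (option {set N}) :=
  bind (max_singleton 0 (enum N)) (fun Delta =>
  bind (while_loop Delta fuel 0 Delta init_state) (fun ost =>
  if ost is Some st then best_set None [seq solution st j | j <- enum 'I_l]
  else Ret None)).

End FastSGS.

Definition valid_order (N : finType) (l : nat) (ord : nat -> seq (N * 'I_l)) :=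
  forall i, perm_eq (ord i) (enum {: N * 'I_l}).

(* The algorithm halts with output [S] after exactly [q] oracle calls.  The
   result does not depend on [fuel] once it is large enough, so a proof of
   [fastSGS_returns] includes termination. *)
Definition fastSGS_returns (R : realType) (N : finType) (f : {set N} -> R)
    (I : {set {set N}}) (l : nat) (eps : R) (ord : nat -> seq (N * 'I_l))
    (S : {set N}) (q : nat) : Prop :=
  exists fuel, exec f I (fastSGS eps ord fuel) = (Some S, q).

(* With constants [C] and [c], [q] is in soft-O of [g]: O(g log^c g). *)
Definition soft_O_bound (R : realType) (C : R) (c : nat) (g : R) (q : nat) :=
  q%:R <= C * (g * ln g ^+ c).

(* Main.v *)
Require Import Defs.
From mathcomp Require Import all_boot all_order all_algebra.
From mathcomp Require Import reals sequences exp.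
From mathcomp Require Import ring lra.

Set Implicit Arguments.
Unset Strict Implicit.
Unset Printing Implicit Defensive.

Import Order.TTheory GRing.Theory Num.Theory.
Local Open Scope ring_scope.

(* Write S_j for the final solutions and charge each pair (o, j) with o in
   OPT :\: S_j to an addition made by the algorithm.  By k-extendibility an
   addition of u to solution j spoils at most k elements of OPT for that
   solution if u is not in OPT, and none if u is in OPT; in the latter case it
   makes u unavailable to the l - 1 <= k other solutions.  Since an available
   admissible element gains at most tau / (1 - eps) when the threshold is tau,
   the charged pairs cost at most k / (1 - eps) times the total value of the
   S_j.  The uncharged pairs have marginals below the last threshold, and
   the largest f (S_j) is at least a third of the largest singleton value, so
     (1 - eps)^2 * sum_j f (OPT :|: S_j) <= l * (k + 1) * max_j f (S_j).
   The left sum is at least l * f OPT when f is monotone, and at least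
   (l - 1) * f OPT in general because the S_j are disjoint. *)

Definition marginal (R : realType) (N : finType) (f : {set N} -> R) (u : N)
  (S : {set N}) : R := f (u |: S) - f S.

(** * Inequalities for submodular functions *)

Section Submodular.
Variables (R : realType) (N : finType) (f : {set N} -> R).
Hypothesis submod_f : submodular f.
Implicit Types (S T O : {set N}) (u : N).

Lemma marginal_antitone u S T :
  S \subset T -> u \notin T -> marginal f u T <= marginal f u S.
Proof.
move=> sST uT; have := submod_f (u |: S) T.
have -> : u |: S :|: T = u |: T by rewrite -setUA (setUidPr sST).
have -> : (u |: S) :&: T = S.
  rewrite setIUl (setIidPl sST); apply/setUidPr/subsetP => x.
  by rewrite !inE => /andP[/eqP-> uT']; rewrite uT' in uT.
by rewrite /marginal; lra.
Qed.

(** When the elements of [O :\: S] are added one at a time, each gains at most its marginal over [S]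
    itself, by [marginal_antitone]. *)
Lemma union_le_sum_marginal O S :
  f (O :|: S) <= f S + \sum_(o in O :\: S) marginal f o S.
Proof.
have [m le_m] := ubnP #|O :\: S|; elim: m O le_m => // m IHm O.
have [D0|[u uD]] := set_0Vmem (O :\: S) => le_m.
  rewrite D0 big_set0 addr0; suff -> : O :|: S = S by [].
  by apply/setUidPr; rewrite -setD_eq0 D0.
have DE : (O :\ u) :\: S = (O :\: S) :\ u by rewrite !setDDl setUC.
have [uS uO] : u \notin S /\ u \in O by move: uD; rewrite inE => /andP[].
have := IHm (O :\ u); rewrite DE; rewrite (cardsD1 u) uD in le_m.
move=> /(_ le_m) le1; rewrite (big_setD1 u uD) /=.
have := @marginal_antitone u S (O :\ u :|: S) (subsetUr _ _).
rewrite !inE eqxx /= => /(_ uS); rewrite {1}/marginal setUA setD1K //.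
by lra.
Qed.

(** By disjointness, [O :|: S j] meets the union of [O] with the sets already joined exactly in [O].
    One use of submodularity thus handles each further set, and nonnegativity discards the value of
    the full union. *)
Lemma sum_union_disjoint_ge (J : finType) (S : J -> {set N}) O :
  nonnegative f -> (forall i j, i != j -> [disjoint S i & S j]) ->
  #|J|%:R * f O <= \sum_j f (O :|: S j) + f O.
Proof.
move=> f0 disj.
suff gen (s : seq J) : uniq s ->
    f (O :|: \bigcup_(j <- s) S j) + (size s)%:R * f O
      <= \sum_(j <- s) f (O :|: S j) + f O.
  have := gen (enum J) (enum_uniq J); rewrite -cardE.
  rewrite [\sum_(j <- enum J) _]big_enum /=.
  by have := f0 (O :|: \bigcup_(j <- enum J) S j); lra.
elim: s => [|j s IHs] /=; first by rewrite !big_nil setU0 mul0r add0r addr0.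
case/andP=> js /IHs {}IHs; rewrite !big_cons -natr1.
have := submod_f (O :|: S j) (O :|: \bigcup_(i <- s) S i).
rewrite -setUIr setUACA setUid.
suff -> : S j :&: \bigcup_(i <- s) S i = set0 by rewrite setU0; lra.
apply/setP => x; rewrite !inE; apply/negP => /andP[xj].
rewrite big_seq; apply/negP; elim/big_ind: _; rewrite ?inE //.
  by move=> A B xA xB; rewrite inE negb_or xA.
move=> i is_; have /disj : j != i by apply: contraNneq js => ->.
by rewrite disjoint_sym => /disjointFl->.
Qed.
End Submodular.

(** * Threshold additions and the charging argument *)

Section ThresholdRuns.
Variables (R : realType) (N : finType) (f : {set N} -> R) (I : {set {set N}}).
Variables (l : nat) (eps : R).
Hypothesis submod_f : submodular f.
Implicit Types (st : state N l) (u o : N) (i j : 'I_l) (tau t : R).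

Definition low_pair t st (p : N * 'I_l) : Prop :=
  p.1 \in available st -> p.1 |: solution st p.2 \in I ->
  marginal f p.1 (solution st p.2) <= t.

(* Forgets the passes: all that the analysis needs to know about an addition
   with threshold [tau] is that no admissible pair gained more than
   [tau / (1 - eps)] at that time. *)
Inductive reachable : state N l -> Prop :=
  | reachable_init : reachable (init_state N l)
  | reachable_add st u j tau :
      reachable st -> u \in available st -> u |: solution st j \in I ->
      0 <= tau -> tau <= marginal f u (solution st j) ->
      (forall p, low_pair (tau / (1 - eps)) st p) ->
      reachable (add_to st u j).

Lemma solution_add st u j i :
  solution (add_to st u j) i =
  (if i == j then u |: solution st i else solution st i).
Proof. by rewrite ffunE. Qed.

Lemma solution_sub_add st u j i :
  solution st i \subset solution (add_to st u j) i.
Proof. by rewrite solution_add; case: ifP => // _; apply: subsetUr. Qed.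

Lemma reachable_unavailable st j u :
  reachable st -> u \in solution st j -> u \notin available st.
Proof.
move=> r; elim: r j => {st} [j|st v i tau _ IH _ _ _ _ _ j].
  by rewrite ffunE inE.
rewrite solution_add [available _]/= !inE negb_and negbK.
case: eqP => [->|_ /IH->]; last by rewrite orbT.
by rewrite !inE => /orP[-> //|/IH->]; rewrite orbT.
Qed.

Lemma reachable_disjoint st i j :
  reachable st -> i != j -> [disjoint solution st i & solution st j].
Proof.
move=> r; elim: r i j => {st} [i j _|st v m tau r IH vA _ _ _ _ i j ij].
  by rewrite ffunE -setI_eq0 set0I.
have vS h : v \notin solution st h.
  by apply: contraL vA => /(reachable_unavailable r).
rewrite !solution_add; have := IH _ _ ij; rewrite -!setI_eq0 => /eqP dij.
apply/eqP/setP => x; have := congr1 (fun A : {set N} => x \in A) dij.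
rewrite !inE.
have [im|im] := eqVneq i m; have [jm|jm] := eqVneq j m => //.
- by rewrite im jm eqxx in ij.
- by rewrite !inE; have [->|//] := eqVneq x v; rewrite !(negPf (vS _)) ?andbF.
- by rewrite !inE; have [->|//] := eqVneq x v; rewrite !(negPf (vS _)) ?andbF.
Qed.

Lemma reachable_indep st j :
  independence_system I -> reachable st -> solution st j \in I.
Proof.
move=> [/set0Pn[A AI] dcl]; elim=> {st} [|st u i tau _ IH _ uI _ _ _].
  by rewrite ffunE; apply: dcl AI; apply: sub0set.
by rewrite solution_add; case: eqP => // ->.
Qed.

(** A bound reached in one pass survives to the end of the run: an addition shrinks the available
    set, can only destroy admissibility, and lowers marginals by submodularity. *)
Lemma low_pair_add st u j t p :
  independence_system I -> reachable st -> u \in available st ->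
  low_pair t st p -> low_pair t (add_to st u j) p.
Proof.
move=> [_ dcl] r uA; case: p => o i; rewrite /low_pair /= => low.
rewrite in_setD1 => /andP[ou oA] oI.
apply: le_trans (low oA _); last first.
  by apply: dcl oI; apply/setUS/solution_sub_add.
apply: marginal_antitone => //; first exact: solution_sub_add.
apply: contraL oA; rewrite solution_add.
by case: eqP => _; rewrite ?inE ?(negPf ou) /=; apply: reachable_unavailable.
Qed.

Lemma value_le_add st u j tau i :
  0 <= tau -> tau <= marginal f u (solution st j) ->
  f (solution st i) <= f (solution (add_to st u j) i).
Proof.
move=> tau0 gain; rewrite solution_add; case: eqP => // ->.
by move: gain; rewrite /marginal; lra.
Qed.

(** At the first addition all solutions are empty and [u] is available, so [f [set u] - f set0] is
    at most [tau / (1 - eps)], while the added element gains at least [tau]. Later additions never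
    decrease the value of a solution. *)
Lemma reachable_init_or_large st u :
  0 < eps < 1 -> nonnegative f -> [set u] \in I -> reachable st ->
  st = init_state N l \/ exists j, (1 - eps) * f [set u] <= f (solution st j).
Proof.
move=> /andP[e0 e1] f0 uI.
elim=> {st} [|st v i tau _ IH vA _ tau0 gain low]; [by left|right].
case: IH => [stE|[j le_j]]; last first.
  by exists j; apply: le_trans le_j _; apply: value_le_add gain.
exists i; rewrite solution_add eqxx; move: gain (low (u, i)).
rewrite stE /low_pair /marginal /= !ffunE !setU0 !inE.
move=> gain /(_ isT uI); rewrite ler_pdivlMr ?subr_gt0 // => le_u.
have := f0 set0; nra.
Qed.

(* [Sf j] is the final content of solution [j].  Knowing it in advance, the
   exchange property is applied with [solution st j :|: OPT :&: Sf j] held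
   fixed, so an element of [OPT] never costs [k] exchanged elements when it is
   added; this bounds the charge to each addition by [maxn k l.-1]. *)
Lemma charging k (OPT : {set N}) (Sf : 'I_l -> {set N}) st :
  extendible k I -> OPT \in I -> (l <= k.+1)%N -> eps < 1 ->
  (forall j, Sf j \in I) -> reachable st ->
  (forall j, solution st j \subset Sf j) ->
  exists Rm : 'I_l -> {set N},
    [/\ forall j, Rm j \subset available st :&: (OPT :\: Sf j),
        forall j, Rm j :|: (solution st j :|: OPT :&: Sf j) \in I
      & \sum_j \sum_(o in OPT :\: Sf j :\: Rm j) marginal f o (solution st j)
          <= k%:R / (1 - eps) * \sum_j (f (solution st j) - f set0)].
Proof.
move=> [[_ dcl] ext] OI lk e1 SfI r.
elim: r => {st} [|st u j0 tau r IH uA uI tau0 gain low] sub.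
  (* [Rm j] holds the elements not yet charged; at the start these are all of [OPT :\: Sf j]. *)
  exists (fun j => OPT :\: Sf j); split=> [j|j|].
  - by rewrite /= setTI.
  - by rewrite ffunE set0U setUC setID.
  - rewrite !big1 ?mulr0 // => j _; first by rewrite ffunE subrr.
    by rewrite setDv big_set0.
have e1' : 0 < 1 - eps by rewrite subr_gt0.
have sub' j : solution st j \subset Sf j.
  by apply: subset_trans (sub j); apply: solution_sub_add.
have [Rm [RmD RmI RmP]] := IH sub'.
have uSf : u \in Sf j0.
  by apply: (subsetP (sub j0)); rewrite solution_add eqxx setU11.
have uRm : u \notin Rm j0.
  by apply/negP => /(subsetP (RmD j0)); rewrite !inE uSf andbF.
have [Y [YRm YI cY]] : exists Y : {set N},
    [/\ Y \subset Rm j0,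
       Rm j0 :\: Y :|: (u |: solution st j0 :|: OPT :&: Sf j0) \in I
       & (#|Y| + (l.-1 * (u \in OPT)) <= k)%N].
  have [uO|uO] := boolP (u \in OPT).
    exists set0; rewrite sub0set setD0 cards0 muln1 add0n; split=> //; last first.
      rewrite -ltnS (leq_trans _ lk) //.
      by rewrite ltn_predL (leq_ltn_trans _ (ltn_ord j0)).
    apply: dcl (RmI j0); rewrite !subUset subsetUl sub1set !inE uO uSf !orbT /=.
    by apply/andP; split; apply/subsetP => x; rewrite !inE => ->; rewrite ?orbT.
  pose A := solution st j0 :|: OPT :&: Sf j0; pose B := Rm j0 :|: A.
  have uS : u \notin solution st j0.
    by apply: contraL uA => /(reachable_unavailable r).
  have uB : u \notin B by rewrite !inE !negb_or uRm uS negb_and uO.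
  (* Both [u] and [A] lie inside the independent set [Sf j0]. *)
  have uAI : u |: A \in I.
    by apply: dcl (SfI j0); rewrite !subUset sub1set uSf sub' subsetIr.
  have [Y [/subsetDP[YB YA] cY YI]] := ext A B u (subsetUr _ _) (RmI j0) uB uAI.
  exists Y; rewrite muln0 addn0; split=> //.
    apply/subsetP => x xY; have := subsetP YB x xY.
    by rewrite inE (disjointFr YA xY) orbF.
  apply: dcl YI; rewrite -setUA setUCA setUS // /B setDUl setUS //.
  by apply/subsetDP; split; rewrite // disjoint_sym.
pose Rm' j := if j == j0 then Rm j0 :\: Y else Rm j :\ u.
have sRm' j : Rm' j \subset Rm j.
  by rewrite /Rm'; case: eqP => [->|_]; apply: subsetDl.
exists Rm'; split=> [j|j|].
- apply/subsetP => x xR; have := subsetP (RmD j) x (subsetP (sRm' j) x xR).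
  rewrite !inE => /andP[-> ->]; rewrite !andbT; move: xR; rewrite /Rm'.
  case: eqP => _; rewrite !inE; last by case/andP.
  by case/andP=> _; apply: contraTneq => ->.
- rewrite /Rm' solution_add; case: eqP => [->|_] //.
  by apply: dcl (RmI j); apply/setSU/subsetDl.
have card_Rm : (\sum_j #|Rm j :\: Rm' j| <= k)%N.
  apply: leq_trans cY; rewrite (bigD1 j0) //= {1}/Rm' eqxx.
  apply: leq_add; first by rewrite setDDr setDv set0U subset_leq_card // subsetIr.
  apply: (@leq_trans (\sum_(j < l | j != j0) (u \in OPT))).
    apply: leq_sum => j /negPf jj0; rewrite /Rm' jj0 setDDr setDv set0U.
    have [uO|uO] := boolP (u \in OPT).
      by apply: leq_trans (subset_leq_card (subsetIr _ _)) _; rewrite cards1.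
    rewrite leqn0 cards_eq0 setI_eq0 disjoint_sym disjoints1.
    by apply: contra uO => /(subsetP (RmD j)); rewrite !inE => /and3P[].
  rewrite sum_nat_const leq_mul2r; apply/orP; right.
  by rewrite cardC1 card_ord.
set t := tau / (1 - eps) in low.
have t0 : 0 <= t by rewrite divr_ge0 // ltW.
(* Pairs charged earlier only lose marginal value; those charged now were available and admissible
   just before the addition, so each costs at most [t]. *)
apply: (@le_trans _ _ (\sum_j (\sum_(o in OPT :\: Sf j :\: Rm j)
    marginal f o (solution st j) + #|Rm j :\: Rm' j|%:R * t))).
  apply: ler_sum => j _.
  have IE : (OPT :\: Sf j :\: Rm' j) :&: Rm j = Rm j :\: Rm' j.
    rewrite setIDAC (setIidPr _) //.
    by apply: subset_trans (RmD j) _; apply: subsetIr.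
  have DE : (OPT :\: Sf j :\: Rm' j) :\: Rm j = OPT :\: Sf j :\: Rm j.
    by rewrite setDDl (setUidPr (sRm' j)).
  rewrite (big_setID (Rm j)) /= IE DE addrC.
  apply: lerD.
    apply: ler_sum => o; rewrite !inE => /and3P[_ oS _].
    apply: marginal_antitone => //; first exact: solution_sub_add.
    by apply: contra oS => /(subsetP (sub j)).
  rewrite mulr_natl -sumr_const; apply: ler_sum => o.
  rewrite inE => /andP[_ oR].
  have := subsetP (RmD j) o oR; rewrite !inE => /and3P[oA oS _].
  apply: le_trans (low (o, j) oA _); last first.
    apply: dcl (RmI j); rewrite subUset sub1set inE oR /=.
    by apply/subsetP => x; rewrite !inE => ->; rewrite orbT.
  apply: marginal_antitone => //; first exact: solution_sub_add.
  by apply: contra oS => /(subsetP (sub j)).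
rewrite big_split /= -mulr_suml -natr_sum.
have -> : \sum_j (f (solution (add_to st u j0) j) - f set0) =
    \sum_j (f (solution st j) - f set0) + marginal f u (solution st j0).
  rewrite (bigD1 j0) //= [in RHS](bigD1 j0) //= solution_add eqxx.
  rewrite (eq_bigr (fun j => f (solution st j) - f set0)).
    by rewrite /marginal; ring.
  by move=> j /negPf jj0; rewrite solution_add jj0.
rewrite mulrDr; apply: lerD => //.
apply: (@le_trans _ _ (k%:R * t)); first by rewrite ler_wpM2r // ler_nat.
by rewrite /t mulrA mulrAC ler_wpM2l // divr_ge0 // ltW.
Qed.

(** [charging] is applied with the final solutions as [Sf]. What remains in [Rm j] is still
    available and admissible, so it costs at most [#|N|%:R * t], hence [3 * eps / (1 - eps) * M],
    per solution; the second factor [1 - eps] absorbs this. *)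
Lemma reachable_sum_union_le k (OPT : {set N}) st t Delta M :
  extendible k I -> (0 < k)%N -> OPT \in I -> (l <= k.+1)%N ->
  0 < eps < 1 / 2 -> nonnegative f -> reachable st ->
  (forall p, low_pair t st p) -> 0 <= t ->
  #|N|%:R * t <= eps / (1 - eps) * Delta -> Delta <= 3 * M -> 0 <= M ->
  (forall j, f (solution st j) <= M) ->
  (1 - eps) ^+ 2 * (\sum_j f (OPT :|: solution st j))
    <= l%:R * ((k%:R + 1) * M).
Proof.
move=> extI k0 OI lk /andP[e0 e12] f0 r low t0 nt DM M0 leM.
have e1 : eps < 1 by lra.
have [Rm [RmD RmI RmP]] := charging extI OI lk e1
  (fun j => reachable_indep j extI.1 r) r (fun j => subxx _).
have sum_Rm : \sum_j \sum_(o in Rm j) marginal f o (solution st j)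
    <= l%:R * (#|N|%:R * t).
  rewrite mulr_natl -[in leRHS](card_ord l) -sumr_const; apply: ler_sum => j _.
  apply: (@le_trans _ _ (\sum_(o in Rm j) t)).
    apply: ler_sum => o oR; have := subsetP (RmD j) o oR.
    rewrite !inE => /and3P[oA _ _]; apply: (low (o, j)) => //=.
    apply: extI.1.2 (RmI j); rewrite subUset sub1set inE oR /=.
    by apply/subsetP => x; rewrite !inE => ->; rewrite orbT.
  by rewrite sumr_const -[t *+ _]mulr_natl ler_wpM2r ?ler_nat // max_card.
have sum_M : \sum_j f (solution st j) <= l%:R * M.
  by rewrite mulr_natl -[in leRHS](card_ord l) -sumr_const; apply: ler_sum.
have sum_M0 : \sum_j (f (solution st j) - f set0) <= l%:R * M.
  by apply: le_trans sum_M; apply: ler_sum => j _; rewrite gerBl.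
have sum_U : \sum_j f (OPT :|: solution st j) <=
    \sum_j f (solution st j)
    + (\sum_j \sum_(o in Rm j) marginal f o (solution st j)
    + \sum_j \sum_(o in OPT :\: solution st j :\: Rm j)
        marginal f o (solution st j)).
  rewrite -!big_split; apply: ler_sum => j _ /=.
  apply: le_trans (union_le_sum_marginal submod_f _ _) _.
  rewrite (big_setID (Rm j)) /= (setIidPr _) //.
  exact: subset_trans (RmD j) (subsetIr _ _).
have l0 : 0 <= l%:R :> R by [].
have k1 : 1 <= k%:R :> R by rewrite ler1n.
have e1' : 0 < 1 - eps by rewrite subr_gt0.
have X0 : 0 <= l%:R * M by rewrite mulr_ge0.
have le_sum : \sum_j f (OPT :|: solution st j) <=
    l%:R * M + (k%:R + 3 * eps) / (1 - eps) * (l%:R * M).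
  apply: le_trans sum_U _; apply: lerD => //.
  have -> : (k%:R + 3 * eps) / (1 - eps) * (l%:R * M) =
     l%:R * (eps / (1 - eps) * (3 * M)) + k%:R / (1 - eps) * (l%:R * M) by ring.
  apply: lerD.
    apply: le_trans sum_Rm _; apply: ler_wpM2l => //; apply: le_trans nt _.
    by apply: ler_wpM2l => //; rewrite divr_ge0 // ltW.
  by apply: le_trans RmP _; apply: ler_wpM2l => //; rewrite divr_ge0 // ltW.
apply: le_trans (ler_wpM2l (sqr_ge0 _) le_sum) _.
have -> : (1 - eps) ^+ 2 * (l%:R * M + (k%:R + 3 * eps) / (1 - eps) * (l%:R * M))
    = ((1 - eps) * (1 + k%:R + 2 * eps)) * (l%:R * M).
  by field; rewrite gt_eqF.
have -> : l%:R * ((k%:R + 1) * M) = (k%:R + 1) * (l%:R * M) by ring.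
(* The left factor is [k + 1 - (k - 1) * eps - 2 * eps ^+ 2], at most [k + 1] because [k >= 1]. *)
by apply: ler_wpM2r => //; nra.
Qed.
End ThresholdRuns.

(** * Execution of the oracle program and its query count *)

Section Execution.
Variables (R : realType) (N : finType) (f : {set N} -> R) (I : {set {set N}}).

Lemma exec_bind (T U : Type) (p : prog R N T) (c : T -> prog R N U) :
  exec f I (bind p c) =
  ((exec f I (c (exec f I p).1)).1,
   ((exec f I p).2 + (exec f I (c (exec f I p).1)).2)%N).
Proof.
elim: p => [x|X q IH|X q IH] /=; first by case: exec.
  by rewrite IH; case: (exec f I (q (f X))).
by rewrite IH; case: (exec f I (q (X \in I))).
Qed.

Lemma exec_max_singleton acc us :
  exists D : R, [/\ exec f I (max_singleton acc us) = (D, size us), acc <= D,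
    forall u, u \in us -> f [set u] <= D &
    D = acc \/ exists u, D = f [set u]].
Proof.
elim: us acc => [|u us IH] acc /=; first by exists acc; split=> //; left.
have [D [-> leD geD Dcase]] := IH (Num.max acc (f [set u])).
move: leD; rewrite ge_max => /andP[accD uD]; exists D; split=> //.
  by move=> v; rewrite inE => /predU1P[->|/geD].
case: Dcase => [->|]; last by right.
by rewrite /Num.max; case: ifP => _; [right; exists u|left].
Qed.

Lemma exec_best_set Y s :
  exists X, [/\ exec f I (best_set (Some (Y, f Y)) s) = (Some X, size s),
    X \in Y :: s & forall Z, Z \in Y :: s -> f Z <= f X].
Proof.
elim: s Y => [|Z s IH] Y /=.
  by exists Y; split; rewrite ?mem_head // => Z; rewrite inE => /eqP->.
have [lt_YZ|le_ZY] := ltP (f Y) (f Z).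
  have [X [-> XZ leX]] := IH Z; exists X; split=> //; first by rewrite inE XZ orbT.
  move=> W; rewrite in_cons => /predU1P[->|/leX//].
  by apply: le_trans (ltW lt_YZ) (leX _ (mem_head _ _)).
have [X [-> XY leX]] := IH Y; exists X; split=> //.
  by move: XY; rewrite !inE => /orP[]->; rewrite ?orbT.
move=> W; rewrite !inE => /or3P[/eqP->|/eqP->|Ws].
- exact/leX/mem_head.
- exact: le_trans le_ZY (leX _ (mem_head _ _)).
- by apply: leX; rewrite inE Ws orbT.
Qed.

Variables (l : nat) (eps : R) (ord : nat -> seq (N * 'I_l)).
Hypothesis submod_f : submodular f.
Hypothesis indep_I : independence_system I.
Hypothesis ord_valid : valid_order ord.
Hypothesis eps_itv : 0 < eps < 1 / 2.

Local Notation reachable := (reachable f I eps).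
Local Notation low_pair := (low_pair f I).

Lemma exec_try_pair tau (st : state N l) u j :
  exists st' q, [/\ exec f I (try_pair tau st (u, j)) = (st', q), (q <= 3)%N &
    [/\ u \in available st, u |: solution st j \in I,
        tau <= marginal f u (solution st j) & st' = add_to st u j]
    \/ st' = st /\ low_pair tau st (u, j)].
Proof.
rewrite /try_pair /low_pair /marginal /=.
case: ifP => uA /=; last by exists st, 0%N; split=> //; right.
case: ifP => uI /=; last by exists st, 1%N; split=> //; right.
case: ifP => gain; [exists (add_to st u j), 3%N|exists st, 3%N]; split=> //.
  by left.
by right; split=> // _ _; rewrite leNgt; apply/negP => /ltW; rewrite gain.
Qed.

(** The bound [tau / (1 - eps)] left by the previous pass is what each addition of this pass needs.
    A visited pair ends low for [tau]: either it was rejected, or its element is no longer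
    available. *)
Lemma exec_pass tau s (st : state N l) :
  0 <= tau -> reachable st -> (forall p, low_pair (tau / (1 - eps)) st p) ->
  exists st' q, [/\ exec f I (pass tau s st) = (st', q), (q <= 3 * size s)%N,
    reachable st', forall p, low_pair tau st p -> low_pair tau st' p &
    forall p, p \in s -> low_pair tau st' p].
Proof.
move=> tau0; elim: s st => [|[u j] s IH] st r low; first by exists st, 0%N; split.
have [st1 [q1 [ex1 q13 st1P]]] := exec_try_pair tau st u j.
have [r1 low1 keep1 new1] : [/\ reachable st1,
    forall p, low_pair (tau / (1 - eps)) st1 p,
    forall p, low_pair tau st p -> low_pair tau st1 p & low_pair tau st1 (u, j)].
  case: st1P => [[uA uI gain ->]|[-> ?]]; last by [].
  split=> [|p|p|].
  - exact: reachable_add gain low.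
  - exact: (low_pair_add submod_f indep_I r uA (low p)).
  - exact: (low_pair_add submod_f indep_I r uA).
  - by rewrite /low_pair /= setD11.
have [st' [q [ex2 q2 r' keep new]]] := IH st1 r1 low1.
exists st', (q1 + q)%N; split=> //.
- by rewrite [pass _ _ _]/= exec_bind ex1 /= ex2.
- by rewrite /= mulnS leq_add.
- by move=> p /keep1/keep.
- by move=> p; rewrite inE => /predU1P[->|/new//]; apply: keep.
Qed.

(** [m] counts the passes actually made; the division by [1 - eps] recovers the threshold of the
    last one. The assumption on [fuel] makes the loop condition false at the latest when the fuel is
    spent. *)
Lemma exec_while_loop Delta fuel i tau (st : state N l) :
  0 <= tau -> reachable st -> (forall p, low_pair (tau / (1 - eps)) st p) ->
  (1 - eps) ^+ fuel * tau <= eps / #|N|%:R * Delta ->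
  exists st' q m, [/\
    exec f I (while_loop eps ord Delta fuel i tau st) = (Some st', q),
    (q <= fuel * (3 * (#|N| * l)))%N, reachable st',
    forall p, low_pair ((1 - eps) ^+ m * tau / (1 - eps)) st' p &
    (1 - eps) ^+ m * tau <= eps / #|N|%:R * Delta].
Proof.
have e1 : 0 < 1 - eps by move: eps_itv => /andP[]; lra.
elim: fuel i tau st => [|fuel IH] i tau st tau0 r low small.
  exists st, 0%N, 0%N; rewrite !expr0 !mul1r in small *; split=> //=.
  by rewrite ltNge small.
rewrite [while_loop _ _ _ _ _ _ _]/=; case: ltP => [_|le_tau]; last first.
  by exists st, 0%N, 0%N; rewrite !expr0 !mul1r; split.
have [st1 [q1 [ex1 q13 r1 _ new]]] := exec_pass (ord i) tau0 r low.
have low1 p : low_pair ((1 - eps) * tau / (1 - eps)) st1 p.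
  rewrite mulrAC divff ?gt_eqF // mul1r; apply: new.
  by rewrite (perm_mem (ord_valid i)) mem_enum.
have tau1 : 0 <= (1 - eps) * tau by rewrite mulr_ge0 // ltW.
have := IH i.+1 _ st1 tau1 r1 low1; rewrite mulrA -exprSr => /(_ small).
case=> st' [q [m [ex2 q2 r' low' small']]].
exists st', (q1 + q)%N, m.+1; rewrite exprSr -[_ * _ * tau]mulrA; split=> //.
  by rewrite exec_bind ex1 /= ex2.
rewrite mulSn leq_add // (leq_trans q13) // leq_mul2l.
by rewrite (perm_size (ord_valid i)) -cardT card_prod card_ord leqnn orbT.
Qed.

Lemma exec_fastSGS k fuel :
  extendible k I -> (0 < k)%N -> (forall u, [set u] \in I) -> nonnegative f ->
  (0 < l <= k.+1)%N -> (1 - eps) ^+ fuel * #|N|%:R <= eps ->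
  exists (st : state N l) S q, [/\
    exec f I (fastSGS eps ord fuel) = (Some S, q),
    (q <= #|N| + fuel * (3 * (#|N| * l)) + l)%N, reachable st, S \in I &
    forall OPT, OPT \in I ->
      (1 - eps) ^+ 2 * (\sum_j f (OPT :|: solution st j))
        <= l%:R * ((k%:R + 1) * f S)].
Proof.
move=> extI k0 singI f0 /andP[l0 lk] fuelP; have /andP[e0 e12] := eps_itv.
have e1 : 0 < 1 - eps by lra.
have [D [exD D0 leD Dcase]] := exec_max_singleton 0 (enum N).
(* For empty [N] the quotient [eps / 0] is 0 by convention and [D] is 0 too, so the loop stops at
   once. *)
have D_N : #|N| = 0%N -> D = 0.
  by case: Dcase => [//|[u _]] N0; have := max_card (pred1 u); rewrite card1 N0.
have divD x : x * #|N|%:R <= eps -> x * D <= eps / #|N|%:R * D.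
  move=> le_x; have [/D_N->|N0] := posnP #|N|; first by rewrite !mulr0.
  by rewrite ler_wpM2r // ler_pdivlMr // ltr0n.
have low0 p : low_pair (D / (1 - eps)) (init_state N l) p.
  move=> _ _; rewrite /marginal ffunE setU0 ler_pdivlMr //.
  have := leD p.1; rewrite mem_enum => /(_ isT).
  by have := f0 set0; have := f0 [set p.1]; nra.
have [st [q [m [ex1 q1 r low small]]]] :=
  exec_while_loop 0 D0 (reachable_init f I l eps) low0 (divD _ fuelP).
set t := _ / (1 - eps) in low.
have t0 : 0 <= t by rewrite !(mulr_ge0, invr_ge0, exprn_ge0) // ltW.
have nt : #|N|%:R * t <= eps / (1 - eps) * D.
  have [N0|N0] := posnP #|N|; first by rewrite (D_N N0) N0 mulr0 mul0r.
  rewrite mulrAC /t mulrA ler_pM2r ?invr_gt0 //.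
  have := ler_wpM2l (ler0n R #|N|) small; congr (_ <= _).
  by field; rewrite pnatr_eq0 -lt0n.
pose j0 := Ordinal l0.
have [S [ex2 Sin Smax]] : exists X, [/\
    exec f I (best_set None [seq solution st j | j <- enum 'I_l]) = (Some X, l),
    exists j, X = solution st j & forall j, f (solution st j) <= f X].
  have : size [seq solution st j | j <- enum 'I_l] = l.
    by rewrite size_map size_enum_ord.
  have mem_s Z : Z \in [seq solution st j | j <- enum 'I_l] <->
      exists j, Z = solution st j.
    split=> [/mapP[j _ ->]|[j ->]]; first by exists j.
    by rewrite map_f // mem_enum.
  case: [seq _ | _ <- _] mem_s => [|Y s] mem_s /= size_s.
    by have := ltn_ord j0; rewrite -[ltnRHS]size_s.
  have [X [-> XY Xmax]] := exec_best_set Y s.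
  exists X; split; rewrite ?size_s //; first exact/mem_s.
  by move=> j; apply/Xmax/mem_s; exists j.
exists st, S, (#|N| + (q + l))%N; split=> //.
- rewrite /fastSGS exec_bind exD -cardT /= exec_bind ex1 /=.
  by rewrite ex2.
- by rewrite addnA leq_add2r leq_add2l.
- by have [j ->] := Sin; apply: reachable_indep r.
move=> OPT OI.
apply: (reachable_sum_union_le submod_f extI k0 OI lk eps_itv f0 r low t0 nt)
  => //.
(* It remains to show [D <= 3 * f S]. After some addition, [f S] is at least [(1 - eps) * D], hence
   at least half of [D]. Without additions, [D - t <= f set0 <= f S]. *)
have M0 := f0 S; case: Dcase => [->|[u Du]]; first by rewrite mulr_ge0.
have e01 : 0 < eps < 1 by rewrite e0; lra.
have [stE|[j]] := reachable_init_or_large e01 f0 (singI u) r.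
- move: (Smax j0) (low (u, j0)).
  rewrite stE /low_pair /marginal /= !ffunE setU0 !inE.
  move=> leS /(_ isT (singI u)); rewrite -Du => le_t.
  (* At least two passes take place, because [eps < 1 - eps]. *)
  have N1 : 1 <= #|N|%:R :> R by rewrite ler1n; apply/card_gt0P; exists u.
  have [->|Dn0] := eqVneq D 0; first by rewrite mulr_ge0.
  have Dpos : 0 < D by rewrite lt_def Dn0.
  have le_eps : (1 - eps) ^+ m <= eps.
    have := small; rewrite ler_pM2r // => /le_trans; apply.
    by rewrite ler_pdivrMr ?(lt_le_trans ltr01) //; nra.
  have tE : t * (1 - eps) = (1 - eps) ^+ m * D by rewrite /t mulfVK ?gt_eqF.
  have le_t1 : t <= (1 - eps) * D.
    rewrite -(ler_pM2r e1) tE.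
    case: m le_eps {small low t t0 nt le_t tE} => [|[|m]] le_eps.
    - by move: le_eps; rewrite expr0; lra.
    - by move: le_eps; rewrite expr1; lra.
    rewrite [leRHS]mulrAC ler_wpM2r // !exprS ler_pM2l //.
    by rewrite ler_piMr ?exprn_ile1 ?(ltW e1) //; lra.
  have le_t2 : t * (1 - eps) <= eps * D by rewrite tE ler_wpM2r.
  (* The smaller of [1 - eps] and [eps / (1 - eps)] is at most [(sqrt 5 - 1) / 2 < 2 / 3], so [t] is
     at most two thirds of [D]; this is where the factor 3 comes from. *)
  nra.
by rewrite -Du => leD'; have := Smax j; nra.
Qed.
End Execution.

(** * Number of passes and the soft-O bound *)

Lemma fuel_exists (R : realType) (n : nat) (eps : R) :
  0 < eps < 1 ->
  exists2 m : nat, (1 - eps) ^+ m * n%:R <= eps &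
    (0 < n)%N -> m%:R <= ln (n%:R / eps) / eps + 1.
Proof.
move=> /andP[e0 e1]; have [->|n0] := posnP n.
  by exists 0%N => //; rewrite mulr0 ltW.
have n0R : 0 < n%:R :> R by rewrite ltr0n.
have ne1 : 1 <= n%:R / eps.
  rewrite ler_pdivlMr // mul1r; apply: le_trans (ltW e1) _.
  by rewrite ler1n.
have x0 : 0 <= ln (n%:R / eps) / eps by rewrite divr_ge0 ?ln_ge0 // ltW.
have /andP[le_x lt_x] := truncn_itv x0.
set m := Num.truncn _ in le_x lt_x; exists m.+1; last by rewrite -natr1 lerD2r.
rewrite -ler_pdivlMr //.
(* Since [1 - eps <= expR (- eps)], it is enough that [m.+1 * eps] is at least [ln (n / eps)]. *)
apply: (@le_trans _ _ (expR (- eps) ^+ m.+1)).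
  rewrite lerXn2r ?nnegrE ?expR_ge0 ?subr_ge0 ?(ltW e1) //.
  exact: expR_ge1Dx.
rewrite -expRM_natl -[leRHS]invrK invf_div -[n%:R / eps]lnK ?posrE ?divr_gt0 //.
rewrite -expRN ler_expR mulrN lerN2; move: (ltW lt_x).
by rewrite ler_pdivrMr.
Qed.

(** With [g] the argument of the soft-O, the passes cost at most [6 * g * ln g + 3 * g], by
    [k + 1 <= 2 * k ^+ 2] and [eps < 1 / 2]; the terms [n] and [k + 1] are at most [g] each. As
    [g >= 2], a multiple of [g] is turned into one of [g * ln g] by dividing by [ln 2]. *)
Lemma query_bound_soft_O (R : realType) (n k m q : nat) (eps : R) :
  (0 < n)%N -> (0 < k)%N -> 0 < eps < 1 / 2 ->
  m%:R <= ln (n%:R / eps) / eps + 1 ->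
  (q <= n + m * (3 * (n * k.+1)) + k.+1)%N ->
  soft_O_bound (6 / ln 2 + 6) 1 (k%:R ^+ 2 * n%:R / eps) q.
Proof.
move=> n0 k0 /andP[e0 e12] le_m le_q; rewrite /soft_O_bound expr1.
have n1 : 1 <= n%:R :> R by rewrite ler1n.
have k1 : 1 <= k%:R :> R by rewrite ler1n.
set a := n%:R / eps in le_m; set g := _ / eps.
have nE : n%:R = a * eps by rewrite /a mulfVK ?gt_eqF.
have gE : g = k%:R ^+ 2 * a by rewrite /g mulrA.
have a2 : 2 <= a by rewrite /a ler_pdivlMr //; lra.
have kk1 : 1 <= k%:R ^+ 2 :> R by rewrite exprn_ege1.
have le_ag : a <= g by rewrite gE; nra.
have ln2 : 0 < ln 2 :> R by rewrite ln_gt0 // ltr1n.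
have pos2 : (2 : R) \is Num.pos by rewrite posrE.
have posa : a \is Num.pos by rewrite posrE; lra.
have posg : g \is Num.pos by rewrite posrE; lra.
have le2L : ln 2 <= ln g by rewrite ler_ln //; lra.
have leaL : ln a <= ln g by rewrite ler_ln.
have le_k : k%:R + 1 <= 2 * k%:R ^+ 2 :> R by nra.
have le_k' : k%:R + 1 <= g by rewrite gE; nra.
have le_m' : m%:R * eps <= ln g + eps.
  have := ler_wpM2r (ltW e0) le_m; rewrite mulrDl mul1r mulfVK ?gt_eqF //.
  lra.
have le_mq : m%:R * (3 * (n%:R * (k%:R + 1))) <= 6 * g * (ln g + eps).
  have -> : m%:R * (3 * (n%:R * (k%:R + 1))) = 3 * (m%:R * eps) * (a * (k%:R + 1)).
    by rewrite nE; ring.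
  have -> : 6 * g * (ln g + eps) = 3 * (ln g + eps) * (a * (2 * k%:R ^+ 2)).
    by rewrite gE; ring.
  have a0 : 0 <= a by lra.
  have me0 : 0 <= m%:R * eps by rewrite mulr_ge0 // ltW.
  have k0' : 0 <= k%:R + 1 :> R by lra.
  apply: ler_pM; first by lra.
  - exact: mulr_ge0.
  - by rewrite ler_wpM2l.
  - by rewrite ler_wpM2l.
have le_qR : q%:R <= n%:R + m%:R * (3 * (n%:R * (k%:R + 1))) + (k%:R + 1) :> R.
  by rewrite natr1 -!(natrM, natrD) ler_nat.
have -> : (6 / ln 2 + 6) * (g * ln g) = 6 * g * (ln g / ln 2) + 6 * g * ln g.
  by ring.
have le1 : 1 <= ln g / ln 2 by rewrite ler_pdivlMr // mul1r.
have g0 : 0 <= g by lra.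
have : 6 * g * 1 <= 6 * g * (ln g / ln 2) by rewrite ler_wpM2l // mulr_ge0.
have : n%:R <= g by rewrite nE; nra.
have : g * eps <= g / 2 by nra.
lra.
Qed.

Theorem theorem20 (R : realType) :
  exists (C : R) (c : nat),
  forall (N : finType) (I : {set {set N}}) (f : {set N} -> R) (k : nat) (eps : R),
    0 < eps < 1 / 2 ->
    (0 < k)%N ->
    extendible k I ->
    (forall u : N, [set u] \in I) ->
    nonnegative f ->
    submodular f ->
    (forall ord : nat -> seq (N * 'I_k.+1), valid_order ord ->
       exists (S : {set N}) (q : nat),
         [/\ fastSGS_returns f I eps ord S q,
             (0 < #|N|)%N ->
               soft_O_bound C c (k%:R ^+ 2 * #|N|%:R / eps) q,
             S \in I
           & approx_ratio_le
               ((1 - 2 * eps) ^- 2 * ((k%:R + 1) ^+ 2 / k%:R)) f I S])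
    /\
    (monotone f ->
     forall l : nat, (0 < l <= k.+1)%N ->
     forall ord : nat -> seq (N * 'I_l), valid_order ord ->
       exists (S : {set N}) (q : nat),
         [/\ fastSGS_returns f I eps ord S q,
             S \in I
           & approx_ratio_le ((1 - eps) ^- 2 * (k%:R + 1)) f I S]).
Proof.
exists (6 / ln 2 + 6), 1%N => N I f k eps eps_itv k0 extI singI f0 submod_f.
have /andP[e0 e12] := eps_itv.
have e01 : 0 < eps < 1 by rewrite e0; lra.
have k1 : 1 <= k%:R :> R by rewrite ler1n.
have [m fuelP le_m] := fuel_exists #|N| e01.
have indI := extI.1.
split=> [ord ord_valid|mono_f l l_itv ord ord_valid].
  have [|st [S [q [ex le_q r SI bound]]]] := exec_fastSGS submod_f indI ord_valid
    eps_itv extI k0 singI f0 _ fuelP; first by rewrite leqnn.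
  exists S, q; split=> //; first by exists m.
    by move=> N0; apply: query_bound_soft_O (le_m N0) le_q.
  move=> OPT [OI _].
  have := @sum_union_disjoint_ge _ _ _ submod_f _ (solution st) OPT f0
    (fun i j => @reachable_disjoint _ _ _ _ _ _ _ i j r).
  rewrite card_ord => avg; have := bound _ OI; rewrite -natr1 in avg *.
  set U := \sum_j _ in avg * => le_U.
  (* One of the [k.+1] copies of [f OPT] is lost, which puts [k] in the denominator of the ratio. *)
  have le_kO : k%:R * f OPT <= U by lra.
  have a0 : 0 < (1 - 2 * eps) ^+ 2 by rewrite exprn_gt0 //; lra.
  have b0 : 0 < (k%:R + 1) ^+ 2 / k%:R :> R by rewrite divr_gt0 ?exprn_gt0 //; lra.
  rewrite ler_pdivrMr; last by apply: mulr_gt0; rewrite // invr_gt0.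
  have -> : f S * ((1 - 2 * eps) ^- 2 * ((k%:R + 1) ^+ 2 / k%:R)) =
      (k%:R + 1) * ((k%:R + 1) * f S) / ((1 - 2 * eps) ^+ 2 * k%:R).
    by field; rewrite ?gt_eqF //; lra.
  rewrite ler_pdivlMr; last by apply: mulr_gt0; rewrite // ltr0n.
  apply: le_trans le_U.
  have -> : f OPT * ((1 - 2 * eps) ^+ 2 * k%:R) =
      (1 - 2 * eps) ^+ 2 * (k%:R * f OPT) by ring.
  (* The run achieves the larger factor [(1 - eps) ^+ 2]. *)
  apply: ler_pM => //; first exact: ltW.
    by rewrite mulr_ge0.
  by rewrite ler_pXn2r ?nnegrE //; lra.
have [st [S [q [ex _ r SI bound]]]] := exec_fastSGS submod_f indI ord_valid
  eps_itv extI k0 singI f0 l_itv fuelP.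
exists S, q; split=> //; first by exists m.
move=> OPT [OI _].
have l0 : 0 < l%:R :> R by rewrite ltr0n; case/andP: l_itv.
(* No copy of [f OPT] is lost here, so [l] cancels and the ratio does not depend on it. *)
have le_lO : l%:R * f OPT <= \sum_j f (OPT :|: solution st j).
  rewrite mulr_natl -[in leLHS](card_ord l) -sumr_const; apply: ler_sum => j _.
  exact/mono_f/subsetUl.
have a0 : 0 < (1 - eps) ^+ 2 by rewrite exprn_gt0 //; lra.
have kpos : 0 < k%:R + 1 :> R by lra.
rewrite ler_pdivrMr; last by apply: mulr_gt0; rewrite // invr_gt0.
rewrite mulrCA mulrC ler_pdivlMr // -(ler_pM2l l0).
have := le_trans (ler_wpM2l (ltW a0) le_lO) (bound _ OI).
by congr (_ <= _); ring.
Qed.
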